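(* Let $N\ge1$, $k\ge0$ be integers, $\delta>0$, and $q,m\in[1,+\infty]$. There exists a real $M>0$ depending only on $N$, $k$, $\delta$, $q$ and $m$ such that the following holds. Let $U$ be a (bounded) measurable subset of $\mathbb R^N$ with inradius $r_U$ and diameter $h_U$ such that $\frac{r_U}{h_U}\ge\delta$. Then, for all $w\in\mathbb P^k(U)$, $$M^{-1}\|w\|_{L^q(U)}\le |U|^{\frac1q-\frac1m}\|w\|_{L^m(U)}\le M\|w\|_{L^q(U)}.$$
   Context: $\mathbb P^k(U)$ is the space of (restrictions to $U$ of) polynomials in $N$ variables of total degree $\le k$. The inradius $r_U$ is the radius of the largest ball contained in $U$; $|U|$ is the Lebesgue measure of $U$; $\frac1\infty=0$. *)

(* Defs.v *)
From HB Require Import structures.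
From mathcomp Require Import all_boot all_order all_algebra.
From mathcomp Require Import all_classical all_reals all_analysis.
(* The notations of mpoly clash with those of the analysis library. *)
From mathcomp Require Import (canonicals, coercions) mpoly.

Set Implicit Arguments.
Unset Strict Implicit.
Unset Printing Implicit Defensive.
Import Order.TTheory GRing.Theory Num.Theory.
Import numFieldNormedType.Exports.

Local Open Scope classical_set_scope.
Local Open Scope ring_scope.

Section borel_lebesgue_succ.
Local Open Scope ereal_scope.
Context {R : realType} (n : nat).
Local Notation T := (measurableTypeR R).
Variable mu : {sigma_finite_measure set (n.-tuple T) -> \bar R}.

Definition tuple_cons (p : T * n.-tuple T) : n.+1.-tuple T :=
  [tuple of p.1 :: p.2].

Lemma measurable_tuple_cons : measurable_fun setT tuple_cons.
Proof. exact: measurable_cons. Qed.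

Definition borel_lebesgue_succ : set (n.+1.-tuple T) -> \bar R :=
  pushforward (@lebesgue_measure R \x mu) tuple_cons.

Let succ0 : borel_lebesgue_succ set0 = 0.
Proof. by rewrite /borel_lebesgue_succ /pushforward preimage_set0 measure0. Qed.

Let succ_ge0 A : 0 <= borel_lebesgue_succ A.
Proof. exact: (measure_ge0 (@lebesgue_measure R \x mu)). Qed.

Let succ_sigma_additive : semi_sigma_additive borel_lebesgue_succ.
Proof.
move=> F mF tF mUF; rewrite /borel_lebesgue_succ /pushforward preimage_bigcup.
have mK A : measurable A -> measurable (tuple_cons @^-1` A).
  by move=> mA; rewrite -[X in measurable X]setTI; exact: measurable_tuple_cons.
apply: (measure_semi_sigma_additive (s := @lebesgue_measure R \x mu)).
- by move=> i; exact: mK.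
- apply/trivIsetP => /= i j _ _ ij; rewrite -preimage_setI.
  by move/trivIsetP : tF => /(_ _ _ _ _ ij) ->//; rewrite preimage_set0.
- by rewrite -preimage_bigcup; exact: mK.
Qed.

HB.instance Definition _ := isMeasure.Build _ _ _ borel_lebesgue_succ
  succ0 succ_ge0 succ_sigma_additive.

Let succ_sigma_finite : sigma_finite setT borel_lebesgue_succ.
Proof.
(* Canonical structure inference does not find the sigma-finiteness of the
   product of two sigma-finite measures. *)
have [F TF Foo] : sigma_finite setT (@lebesgue_measure R \x mu).
  have /sigma_finiteP[F [TF ndF Foo]] := sigma_finiteT (@lebesgue_measure R).
  have /sigma_finiteP[G [TG ndG Goo]] := sigma_finiteT mu.
  exists (fun k => F k `*` G k).
    apply/esym; rewrite -subTset => -[x t] _.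
    have [i _ Fx] : (\bigcup_i F i) x by rewrite -TF.
    have [j _ Gt] : (\bigcup_i G i) t by rewrite -TG.
    exists (maxn i j) => //; split => /=.
      exact: (subsetPset _ _ (ndF _ _ (leq_maxl i j))).
    exact: (subsetPset _ _ (ndG _ _ (leq_maxr i j))).
  move=> k; have [mF Fk] := Foo k; have [mG Gk] := Goo k.
  split; first exact: measurableX.
  by rewrite product_measure1E// lte_mul_pinfty// ge0_fin_numE.
pose uncons (t : n.+1.-tuple T) : T * n.-tuple T :=
  (thead t, [tuple of behead t]).
have unconsK p : uncons (tuple_cons p) = p.
  by case: p => x t; rewrite /uncons theadE; congr pair; exact/val_inj.
have muncons : measurable_fun setT uncons.
  apply/measurable_fun_pairP; split; first exact: measurable_tnth.
  exact: measurable_behead.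
exists (fun k => uncons @^-1` F k).
  by rewrite -preimage_bigcup -TF preimage_setT.
move=> k; have [mF Fk] := Foo k; split.
  by rewrite -[X in measurable X]setTI; exact: muncons.
rewrite /borel_lebesgue_succ /pushforward (_ : _ @^-1` _ = F k)//.
by apply/seteqP; split => p /=; rewrite unconsK.
Qed.

HB.instance Definition _ := Measure_isSigmaFinite.Build _ _ _
  borel_lebesgue_succ succ_sigma_finite.

End borel_lebesgue_succ.

(* The n-fold product of the one-dimensional Lebesgue measure, on the Borel
   sets of R^n. *)
Fixpoint borel_lebesgue {R : realType} (n : nat) :
    {sigma_finite_measure set (n.-tuple (measurableTypeR R)) -> \bar R} :=
  if n is n'.+1 then borel_lebesgue_succ (borel_lebesgue n')
  else dirac [tuple].

Section euclidean_space.
Context (R : realType) (n : nat).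

(* R^n with the sigma-algebra of Lebesgue measurable sets, i.e. the sets that
   are Caratheodory measurable for the Lebesgue outer measure. *)
Definition euclidean : measurableType _ :=
  caratheodory_type (mu_ext (@borel_lebesgue R n)).

Definition lebesgue : {measure set euclidean -> \bar R} :=
  @completed_measure_extension _ _ _ (@borel_lebesgue R n).

Definition coordinate (x : euclidean) (i : 'I_n) : R :=
  tnth (x : n.-tuple (measurableTypeR R)) i.

Definition edist (x y : euclidean) : R :=
  Num.sqrt (\sum_(i < n) (coordinate x i - coordinate y i) ^+ 2).

Definition eball (c : euclidean) (r : R) : set euclidean :=
  [set x | edist c x < r].

Definition ebounded (U : set euclidean) : Prop := exists c r, U `<=` eball c r.

(* [sup] on R is 0 on the empty set: a set containing no ball has inradius 0,
   and the empty set has diameter 0. *)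
Definition inradius (U : set euclidean) : R :=
  sup [set r | 0 < r /\ exists c, eball c r `<=` U].

Definition diameter (U : set euclidean) : R :=
  sup [set edist xy.1 xy.2 | xy in U `*` U].

(* [mmeasure mdeg p] is the total degree of p plus one, and 0 for p = 0. The
   values outside U are irrelevant: an element of the space is a function on U.
   *)
Definition polynomials (k : nat) (U : set euclidean) : set (euclidean -> R) :=
  [set w | exists2 p : mpoly.mpoly n R,
    (mpoly.mmeasure mpoly.mdeg p <= k.+1)%N &
    forall x, U x -> w x = mpoly.meval (coordinate x) p].

(* The L^q(U) norm; [f \_ U] is f on U and 0 outside U. *)
Definition LnormOn (q : \bar R) (U : set euclidean) (w : euclidean -> R) :
    \bar R :=
  Lnorm lebesgue q ((EFin \o w) \_ U).

End euclidean_space.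

(* Main.v *)
Require Import Defs.
From HB Require Import structures.
From mathcomp Require Import all_boot all_order all_algebra.
From mathcomp Require Import all_classical all_reals all_analysis.
From mathcomp Require Import measurable_realfun ess_sup_inf qpoly ring lra.
From mathcomp Require Import (canonicals, coercions) mpoly.

(* In one variable, Lagrange interpolation at k+1 separated points of [a, a+s],
   each chosen to minimise |p| on its own subinterval, bounds s |p(x)| by a
   constant times the integral of |p| over [a, a+s] for all x with
   |x - a| <= A s. Tonelli's theorem turns this, one variable at a time, into
   s^N |w(x)| <= C int_Q |w| for a cube Q of side s. The set U contains such a
   cube and lies in a concentric one of comparable side, so that
   |U| sup_U |w| <= M int_U |w|; Hoelder's inequality bounds the integral by
   |U|^(1-1/q) ||w||_q, and ||w||_m <= |U|^(1/m) sup_U |w|. This is one of the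
   two inequalities; exchanging q and m gives the other. *)

Set Implicit Arguments.
Unset Strict Implicit.
Unset Printing Implicit Defensive.
Import Order.TTheory GRing.Theory Num.Theory.
Import numFieldNormedType.Exports.

Local Open Scope classical_set_scope.
Local Open Scope ring_scope.

(** * Pointwise bounds for polynomials in one variable *)

Lemma measurable_norm_EFin d (T : measurableType d) (R : realType) (D : set T)
    (f : T -> R) :
  measurable_fun setT f -> measurable_fun D (fun x => `|f x|%:E).
Proof.
move=> mf; apply/measurable_EFinP; apply: measurableT_comp => //.
exact: measurable_funTS.
Qed.

(** In the Lagrange formula every factor [(x - t j) / (t i - t j)] is at most [d / h] in absolute
    value. *)
Lemma horner_bound_nodes (F : realFieldType) (n : nat) (p : {poly F})
    (t : nat -> F) (x h d : F) :
  (size p <= n)%N -> 0 < h -> h <= d ->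
  (forall i j, i != j -> h <= `|t i - t j|) ->
  (forall j, (j < n)%N -> `|x - t j| <= d) ->
  `|p.[x]| <= (d / h) ^+ n * \sum_(j < n) `|p.[t j]|.
Proof.
case: n => [|n] pn h0 hd tsep tx.
  move: pn; rewrite leqn0 size_poly_eq0 => /eqP ->.
  by rewrite horner0 normr0 big_ord0 mulr0.
have dh1 : 1 <= d / h by rewrite ler_pdivlMr// mul1r.
have t_inj : injective t.
  move=> i j tij; apply: contraTeq h0 => /tsep.
  by rewrite tij subrr normr0 -leNgt.
rewrite {1}(lagrange_gen (ltn0Sn n) t_inj pn) horner_sum mulr_sumr.
apply: le_trans (ler_norm_sum _ _ _) _; apply: ler_sum => i _.
rewrite hornerM hornerC normrM mulrC ler_wpM2r ?normr_ge0//.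
rewrite (lagrangeE (ltn0Sn n) t_inj) /= hornerM hornerC !horner_prod.
rewrite -prodfV -big_split normr_prod /=.
apply: (@le_trans _ _ (\prod_(j < n.+1 | j != i :> nat) (d / h))).
  apply: ler_prod => j ji; rewrite normr_ge0 /= !hornerE normrM mulrC.
  apply: ler_pM; rewrite ?normr_ge0//; first exact: tx.
  by rewrite normfV lef_pV2 ?posrE ?(lt_le_trans h0)// tsep// eq_sym.
(* The factor [j = i] is absent; as [1 <= d / h], the exponent may be raised to the number of
   nodes. *)
by rewrite prodr_const ler_weXn2l// -[leqRHS]card_ord max_card.
Qed.

(** A minimiser [t] of [|p|] on the interval serves: the integral dominates that of the constant
    [|p(t)|]. *)
Lemma exists_horner_le_integral (R : realType) (p : {poly R}) (a b : R) :
  a <= b ->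
  exists2 t, a <= t <= b &
    (((b - a) * `|p.[t]|)%:E
       <= \int[lebesgue_measure]_(y in `[a, b]) `|p.[y]|%:E)%E.
Proof.
move=> ab.
have cp : continuous (fun y => `|p.[y]|).
  move=> y; apply: continuous_comp; first exact: continuous_horner.
  exact: norm_continuous.
have [t tab pt] := EVT_min ab (continuous_subspaceT cp).
exists t; first by move: tab; rewrite in_itv.
have -> : (((b - a) * `|p.[t]|)%:E
    = \int[lebesgue_measure]_(y in `[a, b]) (cst `|p.[t]|%:E) y)%E.
  rewrite integral_cst//= lebesgue_measure_itv/= lte_fin.
  move: ab; rewrite le_eqVlt => /predU1P[->|ab].
    by rewrite ltxx subrr mul0r mule0.
  by rewrite ab -EFinB -EFinM mulrC.
apply: ge0_le_integral => //.
- by move=> y _; rewrite lee_fin.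
- apply: measurable_norm_EFin; apply: continuous_measurable_fun.
  exact: continuous_horner.
Qed.

(* Node spacing h = s / (2(k+1)): the factors of the Lagrange polynomials are
   at most (A+1) s / h = 2(k+1)(A+1). *)
Definition slice_const (R : realType) (k : nat) (A : R) : R :=
  (2 * k.+1%:R) * (2 * k.+1%:R * (A + 1)) ^+ k.+1 * k.+1%:R.

Lemma slice_const_gt0 (R : realType) (k : nat) (A : R) : 0 <= A ->
  0 < slice_const k A.
Proof.
by move=> A0; rewrite /slice_const !mulr_gt0 ?exprn_gt0 ?mulr_gt0 ?ltr_wpDl.
Qed.

(** The point [x] may lie outside [[a, a + s]], because a set extends beyond the cube inscribed in
    it. *)
Lemma horner_le_integral (R : realType) (k : nat) (p : {poly R})
    (A a s x : R) :
  (size p <= k.+1)%N -> 0 <= A -> 0 < s -> `|x - a| <= A * s ->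
  ((s * `|p.[x]|)%:E <= (slice_const k A)%:E *
     \int[lebesgue_measure]_(y in `[a, (a + s)%R]) `|p.[y]|%:E)%E.
Proof.
move=> pk A0 s0 xa.
set J := (\int[_]_(_ in _) _)%E.
have J0 : (0 <= J)%E by apply: integral_ge0 => y _; rewrite lee_fin.
have C0 := slice_const_gt0 k A0.
(* An infinite integral makes the claim trivial, the constant being positive. *)
case EJ : J J0 => [j| |]; last 2 first.
- by move=> _; rewrite gt0_muley ?lte_fin// leey.
- by [].
rewrite lee_fin => j0.
pose h := s / (2 * k.+1%:R).
have h0 : 0 < h by rewrite divr_gt0// mulr_gt0.
have sh : s = 2 * k.+1%:R * h by rewrite /h; field; rewrite nat1r pnatr_eq0.
clearbody h.
(* The interval is cut into [2(k+1)] pieces of length [h]. Node [i] lies in piece [2i], and the odd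
   pieces keep the nodes at least [h] apart. Indices above [k] only complete the sequence, which
   must be separated at all indices. *)
have node i : exists t, [/\ a + i.*2%:R * h <= t, t <= a + i.*2.+1%:R * h &
    (i < k.+1)%N -> h * `|p.[t]| <= j].
  have ab : a + i.*2%:R * h <= a + i.*2.+1%:R * h.
    by rewrite lerD2l ler_pM2r// ler_nat.
  have [t /andP[t1 t2] pt] := exists_horner_le_integral p ab.
  exists t; split=> // ik; rewrite -lee_fin.
  have -> : h = a + i.*2.+1%:R * h - (a + i.*2%:R * h) by rewrite -natr1; ring.
  apply: (le_trans pt); rewrite -EJ; apply: ge0_subset_integral => //.
  - apply: measurable_norm_EFin; apply: continuous_measurable_fun.
    exact: continuous_horner.
  - move=> y /=; rewrite !in_itv/= => /andP[y1 y2]; apply/andP; split.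
      by rewrite (le_trans _ y1)// lerDl mulr_ge0// ltW.
    rewrite (le_trans y2)// lerD2l sh ler_pM2r// -natrM ler_nat mul2n.
    by rewrite -[leqRHS]muln2 -[i.*2]muln2 ltn_mul2r.
have [t tP] := choice node.
have tsep i i' : (i < i')%N -> h <= t i' - t i.
  move=> ii'; have [_ ti _] := tP i; have [ti' _ _] := tP i'.
  have : i.*2.+2%:R * h <= i'.*2%:R * h.
    by rewrite ler_pM2r// ler_nat -doubleS leq_double.
  rewrite -natr1 mulrDl mul1r; lra.
(* The distance [(A + 1) * s] comes from [|x - t i| <= |x - a| + |a - t i| <= A s + s]. *)
have := @horner_bound_nodes _ k.+1 p t x h ((A + 1) * s) pk h0.
have -> : (A + 1) * s / h = 2 * k.+1%:R * (A + 1).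
  by rewrite [in LHS]sh; field; rewrite gt_eqF.
move=> Hp; rewrite -EFinM lee_fin.
have k1 : 1 <= k.+1%:R :> R by rewrite ler1n.
have {}Hp : `|p.[x]| <=
    (2 * k.+1%:R * (A + 1)) ^+ k.+1 * \sum_(i < k.+1) `|p.[t i]|.
  apply: Hp.
  - rewrite sh mulrA; apply: ler_peMl; first exact: ltW.
    by apply: mulr_ege1; [rewrite lerDr|lra].
  - move=> i i'; rewrite neq_ltn => /orP[/tsep|/tsep] ii'.
      by rewrite distrC (le_trans ii')// ler_norm.
    by rewrite (le_trans ii')// ler_norm.
  - move=> i ik; have [t1 t2 _] := tP i.
    have ti : `|a - t i| <= s.
      rewrite ler_norml; apply/andP; split; last first.
        have : 0 <= i.*2%:R * h by rewrite mulr_ge0// ltW.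
        lra.
      have : i.*2.+1%:R * h <= s.
        by rewrite sh ler_pM2r// -natrM ler_nat mul2n ltn_double.
      lra.
    rewrite (_ : x - t i = (x - a) + (a - t i)); last by ring.
    by rewrite (le_trans (ler_normD _ _))// mulrDl mul1r lerD.
(* Bounding each term by the integral over all of [[a, a + s]] costs the last factor [k+1] of
   [slice_const]; its first factor is [s / h]. *)
have Sj : h * (\sum_(i < k.+1) `|p.[t i]|) <= k.+1%:R * j.
  rewrite mulr_sumr; apply: (@le_trans _ _ (\sum_(i < k.+1) j)).
    by apply: ler_sum => i _; have [_ _ ->] := tP i.
  by rewrite sumr_const card_ord mulr_natl.
rewrite /slice_const; set B := (_ ^+ _) in Hp *.
rewrite [in leLHS]sh -!mulrA ler_pM2l// ler_pM2l ?ltr0n//.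
apply: (@le_trans _ _ (h * (B * (\sum_(i < k.+1) `|p.[t i]|)))).
  by rewrite ler_pM2l.
by rewrite mulrCA ler_wpM2l// exprn_ge0// !mulr_ge0// addr_ge0.
Qed.

(** * Cubes, and induction on the number of variables *)

Section boxes.
Context (R : realType).
Local Notation T := (measurableTypeR R).

Definition box n (a : n.-tuple T) (s : R) : set (n.-tuple T) :=
  [set t | forall i, (tnth a i : R) <= tnth t i <= (tnth a i : R) + s].

Lemma tuple_cons_box n (a0 : T) (a : n.-tuple T) (s : R) :
  @tuple_cons R n @^-1` box [tuple of a0 :: a] s =
  `[a0 : R, (a0 : R) + s] `*` box a s.
Proof.
apply/seteqP; split=> -[t0 t] /=.
  move=> h; split=> /= [|i].
    by have := h ord0; rewrite !tnth0 in_itv.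
  by have := h (lift ord0 i); rewrite !tnthS.
rewrite in_itv /= => -[h0 h] i.
by case: (unliftP ord0 i) => [j ->|->]; rewrite ?tnthS ?tnth0.
Qed.

Lemma measurable_box n (a : n.-tuple T) (s : R) : measurable (box a s).
Proof.
have -> : box a s = \bigcap_i
    ((fun t : n.-tuple T => tnth t i) @^-1`
       `[tnth a i : R, (tnth a i : R) + s]).
  apply/seteqP; split=> t; first by move=> h i _; rewrite /= in_itv; exact: h.
  by move=> h i; have := h i I; rewrite /= in_itv.
apply: fin_bigcap_measurable => // i _; rewrite -[X in measurable X]setTI.
by apply: measurable_tnth => //; exact: measurable_itv.
Qed.

Lemma borel_lebesgue_box n (a : n.-tuple T) (s : R) : 0 < s ->
  borel_lebesgue n (box a s) = (s ^+ n)%:E.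
Proof.
move=> s0; elim: n a => [|n IHn] a.
  by rewrite /= diracE mem_set// => -[].
case/tupleP: a => a0 a; rewrite /= /borel_lebesgue_succ /pushforward.
rewrite (tuple_cons_box a0 a) product_measure1E//; last exact: measurable_box.
rewrite [X in (_ * X)%E]IHn.
rewrite [X in (X * _)%E](lebesgue_measure_itv `[a0 : R, (a0 : R) + s]) /=.
rewrite lte_fin ltrDl s0.
by rewrite -EFinB -EFinM addrAC subrr add0r -exprS.
Qed.

(** Polynomiality one variable at a time, in the recursive shape of [borel_lebesgue], for an
    induction that peels off the first coordinate. *)
Fixpoint slicewise_poly (d n : nat) : (n.-tuple T -> R) -> Prop :=
  if n is n'.+1 then fun f =>
    (forall t : n'.-tuple T, exists2 p : {poly R},
       (size p <= d)%N & forall x : R, f (tuple_cons (x, t)) = p.[x]) /\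
    (forall x : T,
       slicewise_poly d (fun t : n'.-tuple T => f (tuple_cons (x, t))))
  else fun=> True.

Lemma measurable_tuple_slice n (f : n.+1.-tuple T -> R) (x : T) :
  measurable_fun setT f ->
  measurable_fun setT (fun t : n.-tuple T => f (tuple_cons (x, t))).
Proof.
move=> mf; apply: measurableT_comp => //.
apply: (@measurableT_comp _ _ _ _ _ _ (@tuple_cons R n)).
  exact: measurable_tuple_cons.
exact: measurable_pair1.
Qed.

(** The induction hypothesis bounds [f] at [x] by an integral over the slice at [x0]; the
    one-variable bound replaces each [|f(x0, t)|] by an integral over the first coordinate; Tonelli
    joins the two integrals. *)
Lemma slicewise_poly_le_integral (k n : nat) (f : n.-tuple T -> R)
    (A s : R) (a x : n.-tuple T) :
  0 <= A -> 0 < s -> slicewise_poly k.+1 f -> measurable_fun setT f ->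
  (forall i, `|(tnth x i : R) - tnth a i| <= A * s) ->
  ((s ^+ n * `|f x|)%:E <= (slice_const k A ^+ n)%:E *
     \int[borel_lebesgue n]_(t in box a s) `|f t|%:E)%E.
Proof.
move=> A0 s0; elim: n f a x => [|n IHn] f a x.
  (* In dimension 0 the measure is the Dirac mass at the empty tuple and the box is the whole
     space. *)
  move=> _ mf _; rewrite !expr0 mul1r mul1e integral_dirac//; last first.
  - exact: measurable_norm_EFin.
  - exact: measurable_box.
  by rewrite diracE mem_set ?mul1e ?(tuple0 x)// => -[].
case/tupleP: a => a0 a; case/tupleP: x => x0 x [fp fs] mf xa.
have C0 := slice_const_gt0 k A0.
have mcf : measurable_fun setT (f \o @tuple_cons R n).
  by apply: measurableT_comp => //; exact: measurable_tuple_cons.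
have mas := measurable_box a s.
rewrite /= /borel_lebesgue_succ.
rewrite (ge0_integral_pushforward (measurable_tuple_cons (n := n)));
  last 3 first.
- exact: measurable_box.
- exact: measurable_norm_EFin.
- by move=> t _; rewrite lee_fin.
(* Tonelli is applied on the whole product, so the integrand is extended by 0 outside the box. *)
rewrite (tuple_cons_box a0 a) integral_mkcond.
set F := patch _ _ _.
have F0 z : (0 <= F z)%E.
  by rewrite /F patchE; case: ifP => // _; rewrite lee_fin.
have mF : measurable_fun setT F.
  apply/(measurable_restrictT _ _).1; first exact: measurableX.
  exact: measurable_norm_EFin.
rewrite (fubini_tonelli2 F)//.
(* [G t] integrates [F] over the first coordinate, the others being fixed at [t]. *)
set G := fubini_G _ _.
have mG : measurable_fun setT G by exact: measurable_fun_fubini_tonelli_G.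
have G0 t : (0 <= G t)%E by apply: integral_ge0.
have xa' i : `|(tnth x i : R) - tnth a i| <= A * s.
  by have := xa (lift ord0 i); rewrite !tnthS.
have mfx := measurable_tuple_slice x0 mf.
have Gge t : box a s t ->
    ((s * `|f (tuple_cons (x0, t))|)%:E <= (slice_const k A)%:E * G t)%E.
  move=> ta; have [p pk fpE] := fp t.
  rewrite fpE; have := xa ord0; rewrite !tnth0 => x0a.
  apply: le_trans (horner_le_integral pk A0 s0 x0a) _.
  rewrite le_eqVlt; apply/orP; left; apply/eqP; congr (_ * _)%E.
  rewrite integral_mkcond; apply: eq_integral => y _.
  rewrite /F !patchE /=; congr (if _ then _ else _); last by rewrite fpE.
  by apply/idP/idP; rewrite !inE => // -[].
have := IHn _ a x (fs x0) mfx xa'.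
set I := integral _ _ _ => IH.
apply: (@le_trans _ _ ((slice_const k A ^+ n)%:E * (s%:E * I))%E).
  by rewrite muleCA exprS -mulrA EFinM lee_pmul2l ?lte_fin.
rewrite exprSr EFinM -muleA lee_pmul2l ?lte_fin ?exprn_gt0//.
have mfx' : measurable_fun (box a s) (fun t => `|f (tuple_cons (x0, t))|%:E).
  exact: measurable_norm_EFin.
have -> : (s%:E * I = \int[borel_lebesgue n]_(t in box a s)
    (s%:E * `|f (tuple_cons (x0, t))|%:E))%E.
  by rewrite ge0_integralZl_EFin//; exact: ltW.
have -> : ((slice_const k A)%:E * (\int[borel_lebesgue n]_t G t) =
    \int[borel_lebesgue n]_t ((slice_const k A)%:E * G t))%E.
  by rewrite ge0_integralZl_EFin//; exact: ltW.
apply: (@le_trans _ _ (\int[borel_lebesgue n]_(t in box a s)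
    ((slice_const k A)%:E * G t))%E).
  apply: ge0_le_integral => //.
  - by move=> t _; rewrite mule_ge0// lee_fin ltW.
  - exact: emeasurable_funM.
  - by apply: emeasurable_funM => //; exact: measurable_funTS.
apply: ge0_subset_integral => //.
- by apply: emeasurable_funM.
- by move=> t _; rewrite mule_ge0// lee_fin ltW.
Qed.
End boxes.

(** * Polynomials of bounded total degree, slice by slice *)

Section polynomial_slices.
Context (R : realType).
Local Notation T := (measurableTypeR R).

Lemma slicewise_poly_scale (d n : nat) (f : n.-tuple T -> R) (c : R) :
  slicewise_poly d f -> slicewise_poly d (fun t => c * f t).
Proof.
elim: n f => //= n IHn f [fp fs]; split=> [t|x]; last exact: IHn.
have [p pd fpE] := fp t; exists (c *: p).
  exact: leq_trans (size_scale_leq _ _) pd.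
by move=> x; rewrite hornerZ fpE.
Qed.

Lemma slicewise_poly_sum (d n : nat) (I : Type) (r : seq I) (P : pred I)
    (f : I -> n.-tuple T -> R) :
  (forall i, P i -> slicewise_poly d (f i)) ->
  slicewise_poly d (fun t => \sum_(i <- r | P i) f i t).
Proof.
elim: n f => //= n IHn f fP; split=> [t|x]; last first.
  by apply: (IHn (fun i t => f i (tuple_cons (x, t)))) => i /fP[].
have /choice[p pP] i : exists p : {poly R}, P i -> (size p <= d)%N /\
    forall x : R, f i (tuple_cons (x, t)) = p.[x].
  have [/fP[/(_ t)[p]]|] := boolP (P i); last by exists 0.
  by exists p.
exists (\sum_(i <- r | P i) p i).
  apply: leq_trans (size_sum _ _ _) _; elim/big_ind: _ => //.
    by move=> x y xd yd; rewrite geq_max xd.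
  by move=> i /pP[].
by move=> x; rewrite horner_sum; apply: eq_bigr => i /pP[].
Qed.

Lemma slicewise_poly_monomial (k n : nat) (e : 'I_n -> nat) :
  (forall i, (e i <= k)%N) ->
  slicewise_poly k.+1 (fun t => \prod_i (tnth t i : R) ^+ e i).
Proof.
elim: n e => //= n IHn e ek; split=> [t|x].
  exists ((\prod_i (tnth t i : R) ^+ e (lift ord0 i)) *: 'X^(e ord0)).
    by rewrite (leq_trans (size_scale_leq _ _))// size_polyXn ltnS.
  move=> x; rewrite hornerZ hornerXn big_ord_recl tnth0 mulrC.
  by congr (_ * _); apply: eq_bigr => i _; rewrite tnthS.
have -> : (fun t : n.-tuple T =>
      \prod_i (tnth (tuple_cons (x, t)) i : R) ^+ e i) =
    (fun t => (x : R) ^+ e ord0 * \prod_i (tnth t i : R) ^+ e (lift ord0 i)).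
  apply/funext => t; rewrite big_ord_recl tnth0.
  by congr (_ * _); apply: eq_bigr => i _; rewrite tnthS.
by apply: slicewise_poly_scale; apply: IHn.
Qed.

(** In each monomial of the expansion the exponent of a single variable is at most the total
    degree. *)
Lemma slicewise_poly_meval (k n : nat) (p : mpoly.mpoly n R) :
  (mpoly.mmeasure mpoly.mdeg p <= k.+1)%N ->
  slicewise_poly k.+1
    (fun t : n.-tuple T => mpoly.meval (fun i => tnth t i : R) p).
Proof.
move=> pk.
have -> : (fun t : n.-tuple T => mpoly.meval (fun i => tnth t i : R) p) =
    fun t => \sum_(m <- mpoly.msupp p | m \in mpoly.msupp p)
      mpoly.mcoeff m p * \prod_i (tnth t i : R) ^+ mpoly.fun_of_multinom m i.
  by apply/funext => t; rewrite mpoly.mevalE big_seq.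
apply: slicewise_poly_sum => m mp; apply: slicewise_poly_scale.
apply: slicewise_poly_monomial => i.
(* [mmeasure mdeg] is the total degree plus one, hence the strict inequality. *)
have : (mpoly.mdeg m < k.+1)%N.
  exact: leq_trans (mpoly.mmeasure_mnm_lt mpoly.mdeg mp) pk.
by rewrite ltnS; apply: leq_trans; rewrite mpoly.mdegE (bigD1 i)//= leq_addr.
Qed.

Lemma measurable_meval (n : nat) (p : mpoly.mpoly n R) :
  measurable_fun setT
    (fun t : n.-tuple T => mpoly.meval (fun i => tnth t i : R) p).
Proof.
under eq_fun do rewrite mpoly.mevalE.
apply: measurable_sum => m; apply: measurable_funM => //.
apply: measurable_prod => i _; apply: measurable_funX.
exact: measurable_tnth.
Qed.
End polynomial_slices.

(** * Lebesgue measure against the Borel product measure *)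

Section lebesgue_borel.
Context (R : realType) (n : nat).
Local Notation T := (measurableTypeR R).

(* The identity, from the Lebesgue to the Borel sigma-algebra. *)
Definition euclidean_tuple (x : euclidean R n) : n.-tuple T := x.

Lemma measurable_euclidean_tuple : measurable_fun setT euclidean_tuple.
Proof.
move=> _ A mA; rewrite setTI; apply: sub_caratheodory.
exact: sub_sigma_algebra.
Qed.

Lemma lebesgueE (A : set (n.-tuple T)) : measurable A ->
  lebesgue R n A = borel_lebesgue n A.
Proof. by move=> mA; exact: measurable_mu_extE. Qed.

(** This links the Borel product measure, used for Tonelli, to Lebesgue measure, used in the norms:
    the former is the image of the latter under the identity. *)
Lemma ge0_integral_lebesgue (A : set (n.-tuple T)) (f : n.-tuple T -> \bar R) :
  measurable A -> measurable_fun A f -> (forall t, (0 <= f t)%E) ->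
  (\int[lebesgue R n]_(x in A) f x = \int[borel_lebesgue n]_(t in A) f t)%E.
Proof.
move=> mA mf f0.
have := ge0_integral_pushforward measurable_euclidean_tuple (lebesgue R n) mA mf
  (fun t _ => f0 t).
move=> /esym -> /=; apply: eq_measure_integral => [|mphi B mB _].
  exact: measurable_euclidean_tuple.
exact: lebesgueE.
Qed.
End lebesgue_borel.

(** * Norms of a function supported in a set of finite positive measure *)

Section Lnorm_support.
Local Open Scope ereal_scope.
Context d (T : measurableType d) (R : realType).
Variable mu : {measure set T -> \bar R}.
Variables (U : set T) (u : R) (f : T -> R).
Hypotheses (mU : measurable U) (u_gt0 : (0 < u)%R) (muU : mu U = u%:E).
Hypotheses (mf : measurable_fun setT f) (f_out : forall x, ~ U x -> f x = 0%R).

(** The norm at [+oo] is defined as the essential supremum only when the whole space has positive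
    measure. *)
Let muT_gt0 : 0 < mu setT.
Proof.
apply: (@lt_le_trans _ _ (mu U)); first by rewrite muU lte_fin.
by apply: le_measure; rewrite ?inE.
Qed.

(** Hoelder's inequality for the product of [f] with the indicator of [U], which is [f] itself; the
    endpoints are treated apart. *)
Lemma integral_abs_le_Lnorm (q : \bar R) : 1 <= q ->
  \int[mu]_x `|f x|%:E <= (u `^ (1 - fine q^-1))%:E * 'N[mu]_q[EFin \o f].
Proof.
case: q => [r| |]// r1; last first.
  (* For [q = +oo] the exponent of [u] is 1, and [|f|] is almost everywhere at most its essential
     supremum. *)
  rewrite invey subr0 (powRr1 (ltW u_gt0)) unlock muT_gt0.
  have -> : \int[mu]_x `|f x|%:E = \int[mu]_(x in U) `|f x|%:E.
    rewrite [RHS]integral_mkcond; apply: eq_integral => x _.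
    rewrite patchE; case: ifPn => // /negP; rewrite inE => /f_out ->.
    by rewrite normr0.
  rewrite muleC -muU -integral_cst//.
  apply: ae_ge0_le_integral => //.
  - exact: measurable_norm_EFin.
  - move=> x _; apply: ess_sup_gee => //; apply/nearW => y /=.
    by rewrite lee_fin.
  - by have := ess_sup_ge mu (abse \o (EFin \o f)); apply: filterS => x /=.
move: r1; rewrite lee_fin le_eqVlt => /predU1P[<-|r1].
  by rewrite inve1 subrr powRr0 mul1e Lnorm1.
have r0 : (0 < r)%R by exact: lt_trans r1.
rewrite fine_invr.
(* The conjugate exponent of [r]; the indicator of [U] has norm [u^(1/r')]. *)
pose r' := (1 - r^-1)^-1%R.
have r'0 : (0 < r')%R by rewrite invr_gt0 subr_gt0 invf_lt1.
have rr'1 : (r^-1 + r'^-1 = 1)%R by rewrite /r' invrK subrKC.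
have := hoelder mu mf (measurable_indic mU) r0 r'0 rr'1.
have -> : (f \* \1_U)%R = f.
  apply/funext => x /=; rewrite indicE.
  case: (boolP (x \in U)) => [|/negP]; rewrite ?mulr1//.
  by rewrite inE => /f_out ->; rewrite mul0r.
have -> : 'N[mu]_r'%:E[EFin \o \1_U] = (u `^ (1 - r^-1))%:E.
  rewrite unlock /r' invrK -/r'.
  have -> : \int[mu]_x (`|(EFin \o \1_U) x| `^ r') = mu U.
    rewrite -[RHS]mul1e -integral_cst// [RHS]integral_mkcond.
    apply: eq_integral => x _; rewrite /= indicE patchE.
    by case: (x \in U) => /=; rewrite ?normr1 ?powR1 ?normr0 ?powR0// gt_eqF.
  by rewrite muU.
by rewrite Lnorm1 muleC; exact.
Qed.

(** For finite [m], [|f|^m] is dominated by [S^m] times the indicator of [U]. *)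
Lemma Lnorm_le_bound (m : \bar R) (S : R) : 1 <= m -> (0 <= S)%R ->
  (forall x, `|f x| <= S)%R ->
  'N[mu]_m[EFin \o f] <= (S * u `^ (fine m^-1))%:E.
Proof.
case: m => [r| |]// r1 S0 fS; last first.
  rewrite invey powRr0 mulr1 unlock muT_gt0; apply/ess_supP/nearW => x /=.
  by rewrite lee_fin.
rewrite lee_fin in r1; have r0 : (0 < r)%R by exact: lt_le_trans r1.
rewrite fine_invr unlock.
(* Written as an [r]-th root, the bound follows from a comparison of integrals. *)
have -> : (S * u `^ r^-1)%:E = ((S `^ r * u)%:E) `^ r^-1.
  rewrite poweR_EFin powRM ?powR_ge0// -?powRrM ?mulfV ?gt_eqF ?powRr1//.
  exact: ltW.
apply: gt0_ler_poweR.
- by rewrite invr_ge0 ltW.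
- by rewrite in_itv /= leey andbT; apply: integral_ge0 => x _.
- by rewrite in_itv /= leey andbT lee_fin mulr_ge0 ?powR_ge0// ltW.
rewrite EFinM -muU -integral_cst// [leRHS]integral_mkcond.
apply: ge0_le_integral => //.
- by move=> x _; exact: poweR_ge0.
- apply/measurable_EFinP.
  apply: (@measurableT_comp _ _ _ _ _ _ (@powR R ^~ r)) => //.
  exact: measurableT_comp.
- apply/(measurable_restrictT _ _).1 => //.
- move=> x _ /=; rewrite patchE; case: ifPn => [_|/negP]; last first.
    by rewrite inE => /f_out ->; rewrite normr0 powR0// gt_eqF.
  by rewrite lee_fin ge0_ler_powR ?nnegrE// ltW.
Qed.
End Lnorm_support.

(** * Cubes inside and around a set of controlled shape *)

Section geometry.
Context (R : realType) (n : nat).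
Local Notation T := (measurableTypeR R).
(* Plain edist is the extended distance of the analysis library. *)
Local Notation edist := (@Defs.edist R n).

Lemma edist_xx (c : euclidean R n) : edist c c = 0.
Proof.
by rewrite /edist big1 ?sqrtr0// => i _; rewrite subrr expr0n.
Qed.

Lemma coordinate_le_edist (x y : euclidean R n) (i : 'I_n) :
  `|coordinate x i - coordinate y i| <= edist x y.
Proof.
rewrite -sqrtr_sqr ler_wsqrtr// (bigD1 i)//= lerDl.
by apply: sumr_ge0 => j _; rewrite sqr_ge0.
Qed.

(** With side [s = r / (n+1)], squared distances from the corner [c] are at most
    [n s^2 < (n+1)^2 s^2 = r^2]. *)
Lemma box_subset_eball (c : euclidean R n) (r : R) : 0 < r ->
  box (c : n.-tuple T) (r / n.+1%:R) `<=` eball c r.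
Proof.
move=> r0 x xc; rewrite /eball /= /edist -[ltRHS]gtr0_norm// -sqrtr_sqr.
rewrite ltr_sqrt ?exprn_gt0//.
set s := r / n.+1%:R in xc.
have s0 : 0 < s by rewrite divr_gt0.
have rs : r = n.+1%:R * s by rewrite /s mulrC divfK// pnatr_eq0.
clearbody s; apply: (@le_lt_trans _ _ (\sum_(i < n) s ^+ 2)).
  apply: ler_sum => i _; have /andP[x1 x2] := xc i.
  rewrite -[leLHS]sqrrN; apply: lerXn2r; rewrite ?nnegrE /coordinate; lra.
rewrite sumr_const card_ord -[ltLHS]mulr_natl rs exprMn ltr_pM2r ?exprn_gt0//.
by rewrite -natrX ltr_nat (leq_trans (ltnSn n))// expnS leq_pmulr.
Qed.

(** [U] contains a ball of radius [r] with [diameter U < 2 r / delta]; the cube has its corner at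
    the centre of the ball and side [s = r / (n+1)]. *)
Lemma inradius_diameter_box (U : set (euclidean R n)) (delta : R) :
  0 < delta -> delta <= inradius U / diameter U ->
  exists (c : n.-tuple T) (s : R), [/\ 0 < s, box c s `<=` U &
    forall x i, U x ->
      `|coordinate x i - tnth c i| <= 2 * n.+1%:R / delta * s].
Proof.
move=> d0 dU.
(* Division by 0, and [sup] of a set without supremum, give 0; a positive ratio excludes both, so
   the two suprema are genuine. *)
have ratio0 : inradius U / diameter U != 0 by rewrite gt_eqF// (lt_le_trans d0).
have [inr0 diam0] : inradius U != 0 /\ diameter U != 0.
  by move: ratio0; rewrite mulf_eq0 invr_eq0 negb_or => /andP.
have sup_inr : has_sup [set r | 0 < r /\ exists c, eball c r `<=` U].
  by apply: contrapT => /sup_out E; rewrite /inradius E eqxx in inr0.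
have sup_diam : has_sup [set edist xy.1 xy.2 | xy in U `*` U].
  by apply: contrapT => /sup_out E; rewrite /diameter E eqxx in diam0.
have diamP x y : U x -> U y -> edist x y <= diameter U.
  by move=> Ux Uy; apply: ub_le_sup; [exact: sup_diam.2|exists (x, y)].
have diam_gt0 : 0 < diameter U.
  rewrite lt0r diam0 /=; have [_ [[x y] [Ux Uy] _]] := sup_diam.1.
  by rewrite (le_trans _ (diamP x y Ux Uy))// sqrtr_ge0.
(* The inradius need not be attained; halving leaves room for an actual ball. *)
have dinr : delta * diameter U / 2 < inradius U.
  apply: (@lt_le_trans _ _ (delta * diameter U)); last by rewrite -ler_pdivlMr.
  have := mulr_gt0 d0 diam_gt0; lra.
have [r [r0 [c cU]] dr] := sup_gt sup_inr.1 dinr.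
exists c, (r / n.+1%:R); split.
- by rewrite divr_gt0.
- exact: subset_trans (box_subset_eball r0) cU.
- move=> x i Ux; apply: le_trans (coordinate_le_edist x c i) _.
  apply: le_trans (diamP _ _ Ux _) _.
    by apply: cU; rewrite /eball /= edist_xx.
  have -> : 2 * n.+1%:R / delta * (r / n.+1%:R) = 2 * r / delta.
    by field; rewrite nat1r pnatr_eq0 gt_eqF.
  by rewrite ler_pdivlMr// mulrC; lra.
Qed.

Lemma lebesgue_box (a : n.-tuple T) (s : R) : 0 < s ->
  lebesgue R n (box a s) = (s ^+ n)%:E.
Proof.
move=> s0; rewrite -(borel_lebesgue_box a s0).
exact: lebesgueE (measurable_box a s).
Qed.

Lemma measurable_box_euclidean (a : n.-tuple T) (s : R) :
  measurable (box a s : set (euclidean R n)).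
Proof.
rewrite -[X in measurable X]setTI.
exact: measurable_euclidean_tuple (measurable_box a s).
Qed.

(** [U] lies between the cube of side [s] and the cube of side [2 A s] centred at [c]. *)
Lemma lebesgue_comparable_box (U : set (euclidean R n)) (c : n.-tuple T)
    (s A : R) :
  measurable U -> 0 < s -> 0 < A -> box c s `<=` U ->
  (forall x i, U x -> `|coordinate x i - tnth c i| <= A * s) ->
  exists u, [/\ 0 < u, lebesgue R n U = u%:E & u <= (2 * A * s) ^+ n].
Proof.
move=> mU s0 A0 cU UA.
have As0 : 0 < 2 * A * s by rewrite !mulr_gt0.
(* [box] takes its lowest corner, so the centred cube starts at [c - A s]. *)
pose a : n.-tuple T := [tuple ((tnth c i : R) - A * s : T) | i < n].
have leU : (lebesgue R n U <= ((2 * A * s) ^+ n)%:E)%E.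
  rewrite -(lebesgue_box a As0); apply: le_measure; rewrite ?inE//.
    exact: measurable_box_euclidean.
  move=> x Ux i; have := UA x i Ux; rewrite tnth_mktuple ler_norml /coordinate.
  by move=> /andP[x1 x2]; apply/andP; split; lra.
have geU : ((s ^+ n)%:E <= lebesgue R n U)%E.
  rewrite -(lebesgue_box c s0); apply: le_measure; rewrite ?inE//.
  exact: measurable_box_euclidean.
case: (lebesgue R n U) leU geU => [u| |]//; rewrite !lee_fin => u1 u2.
by exists u; split=> //; apply: lt_le_trans u2; rewrite exprn_gt0.
Qed.
End geometry.

(** * The two norm inequalities *)

(** [M] is chosen before [q] and [m], so that the same constant serves after exchanging them. The
    finite positive measure is recorded to allow cancelling powers of it. *)
Lemma LnormOn_polynomial_le (R : realType) (N k : nat) (delta : R) :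
  0 < delta ->
  exists2 M : R, 0 < M & forall (q m : \bar R) (U : set (euclidean R N)),
    (1 <= q)%E -> (1 <= m)%E ->
    measurable U -> delta <= inradius U / diameter U ->
    (exists2 u, 0 < u & lebesgue R N U = u%:E) /\
    forall w : euclidean R N -> R, polynomials k U w ->
      (lebesgue R N U `^ (fine q^-1 - fine m^-1)%R * LnormOn m U w
         <= M%:E * LnormOn q U w)%E.
Proof.
move=> d0; pose A : R := 2 * N.+1%:R / delta.
have A0 : 0 < A by rewrite divr_gt0 ?mulr_gt0.
have C0 := slice_const_gt0 k (ltW A0); set C := slice_const k A in C0.
(* The first factor compares [|U|] with [s^N]; the second comes from [N] one-variable bounds. *)
pose M := (2 * A) ^+ N * C ^+ N.
have M0 : 0 < M by apply: mulr_gt0; apply: exprn_gt0 => //; exact: mulr_gt0.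
exists M => // q m U q1 m1 mU dU.
have [c [s [s0 cU UA]]] := inradius_diameter_box d0 dU.
have [u [u0 Uu us]] := lebesgue_comparable_box mU s0 A0 cU UA.
split; first by exists u.
move=> w [p pk wp].
(* [w] is arbitrary outside [U]; it is replaced by the polynomial [g] and its truncation [f], which
   has the same norms over [U]. *)
pose g (t : N.-tuple (measurableTypeR R)) : R :=
  mpoly.meval (fun i => tnth t i : R) p.
pose f : euclidean R N -> R := g \_ U.
have fU x : U x -> f x = g x by move=> Ux; rewrite /f patchE mem_set.
have f_out x : ~ U x -> f x = 0 by move=> Ux; rewrite /f patchE memNset.
have LE r : LnormOn r U w = 'N[lebesgue R N]_r[EFin \o f]%E.
  rewrite /LnormOn; congr Lnorm; apply/funext => x; rewrite /f /= !patchE.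
  by case: ifPn => // /set_mem/wp /= ->.
have mg : measurable_fun setT g by exact: measurable_meval.
have mge : measurable_fun setT (g : euclidean R N -> R).
  by apply: (measurableT_comp mg); exact: measurable_euclidean_tuple.
have mf : measurable_fun setT f.
  by apply/(measurable_restrictT _ _).1 => //; exact: measurable_funTS.
rewrite !LE Uu poweR_EFin.
case Eq : ('N[lebesgue R N]_q[EFin \o f])%E
    (Lnorm_ge0 (lebesgue R N) q (EFin \o f)) => [nq| |] nq0; last 2 first.
- by rewrite gt0_muley ?lte_fin// leey.
- by [].
rewrite lee_fin in nq0.
have S0 : 0 <= M * u `^ (- fine q^-1) * nq.
  by apply: mulr_ge0 => //; apply: mulr_ge0; [exact: ltW|exact: powR_ge0].
(* The bound on [sup_U |w|]: the cube estimate followed by Hoelder's inequality, then division by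
   [u]. *)
have fbound x : `|f x| <= M * u `^ (- fine q^-1) * nq.
  have [Ux|Ux] := pselect (U x); last by rewrite f_out// normr0.
  have := slicewise_poly_le_integral (ltW A0) s0 (slicewise_poly_meval pk) mg
    (fun i => UA x i Ux).
  rewrite -/C => H.
  have {}H : ((s ^+ N * `|f x|)%:E <= (C ^+ N)%:E *
      ((u `^ (1 - fine q^-1))%:E * nq%:E))%E.
    rewrite fU//; apply: le_trans H _; rewrite lee_pmul2l ?lte_fin ?exprn_gt0//.
    rewrite -Eq.
    apply: le_trans (integral_abs_le_Lnorm mU u0 Uu mf f_out q1).
    rewrite -ge0_integral_lebesgue//; last 2 first.
    + exact: measurable_box.
    + exact: measurable_norm_EFin.
    apply: (@le_trans _ _ (\int[lebesgue R N]_(t in box c s) `|f t|%:E)%E).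
      rewrite le_eqVlt; apply/orP; left; apply/eqP; apply: eq_integral => t.
      by move/set_mem/cU => Ut; rewrite fU.
    apply: ge0_subset_integral => //.
    + exact: measurable_box_euclidean.
    + exact: measurable_norm_EFin.
  rewrite -!EFinM lee_fin in H.
  rewrite -(ler_pM2l u0).
  (* Here [u <= (2 A s)^N] trades the measure of [U] for [s^N]. *)
  apply: (@le_trans _ _ ((2 * A) ^+ N * (s ^+ N * `|f x|))).
    by rewrite mulrA -exprMn ler_wpM2r.
  have -> : u * (M * u `^ (- fine q^-1) * nq) =
      (2 * A) ^+ N * (C ^+ N * (u `^ (1 - fine q^-1) * nq)).
    rewrite powRD ?(gt_eqF u0) ?implybT// powRr1 ?(ltW u0)// /M; ring.
  by rewrite ler_pM2l// exprn_gt0// mulr_gt0.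
have := Lnorm_le_bound mU u0 Uu mf f_out m1 S0 fbound.
move=> /(lee_wpmul2l (_ : 0 <= (u `^ (fine q^-1 - fine m^-1))%:E)%E).
move=> /(_ _)/le_trans; apply; first by rewrite lee_fin powR_ge0.
rewrite -!EFinM lee_fin.
have uE :
    u `^ (fine q^-1 - fine m^-1) * u `^ (- fine q^-1) * u `^ fine m^-1 = 1.
  rewrite -!powRD ?(gt_eqF u0) ?implybT//.
  rewrite (_ : _ + _ = 0) ?powRr0//; ring.
rewrite le_eqVlt; apply/orP; left; apply/eqP.
by rewrite -[RHS]mul1r -uE; ring.
Qed.

Theorem lemma5p1 (R : realType) (N k : nat) (delta : R) (q m : \bar R)
  (N_ge1 : (1 <= N)%N) (delta_gt0 : 0 < delta)
  (q_ge1 : (1 <= q)%E) (m_ge1 : (1 <= m)%E) :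
  exists2 M : R, 0 < M &
    forall U : set (euclidean R N),
      measurable U -> ebounded U -> delta <= inradius U / diameter U ->
      forall w : euclidean R N -> R, polynomials k U w ->
        ((M^-1)%:E * LnormOn q U w
           <= lebesgue R N U `^ (fine q^-1 - fine m^-1)%R * LnormOn m U w
           <= M%:E * LnormOn q U w)%E.
Proof.
have [M M0 HM] := @LnormOn_polynomial_le R N k delta delta_gt0.
exists M => // U mU _ dU w Pw; apply/andP; split; last first.
  by have [_] := HM q m U q_ge1 m_ge1 mU dU; exact.
(* The left inequality is the bound with [q] and [m] exchanged, multiplied by [u^(1/q - 1/m)]. *)
have [[u u0 Uu] /(_ w Pw)] := HM m q U m_ge1 q_ge1 mU dU.
rewrite Uu !poweR_EFin => H.
rewrite lee_pdivrMl//.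
have upos : (0 < (u `^ (fine q^-1 - fine m^-1))%:E)%E.
  by rewrite lte_fin powR_gt0.
have -> : (LnormOn q U w = (u `^ (fine q^-1 - fine m^-1))%:E *
    ((u `^ (fine m^-1 - fine q^-1))%:E * LnormOn q U w))%E.
  rewrite muleA -EFinM -powRD ?(gt_eqF u0) ?implybT//.
  by rewrite addrA subrK subrr powRr0 mul1e.
by rewrite [leRHS]muleCA lee_pmul2l.
Qed.
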